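(* There are absolute constants $c,C>0$ such that the following holds. Let $\mathcal{X}=\mathcal{X}_1\times\cdots\times\mathcal{X}_n$ be a finite product space with a probability distribution $\pi$ on it, and let $\mathsf{P}=\mathsf{P}_n\cdots\mathsf{P}_1$ denote the transition matrix of the systematic scan with the identity permutation. Then $$\frac{c}{\sqrt{n\gamma_{\mathsf{P}}}}\le t^{\mathsf{P}}_{\mathsf{mix}}(1/10)\le\frac{C}{\gamma_{\mathsf{P}}}\log\left(\frac{1}{\pi_{\min}}\right),$$ where $\pi_{\min}=\min_{x\in\mathcal{X}:\pi(x)\ne0}\pi(x)$.
   Context: For $i\in\{1,\dots,n\}$, $\mathsf{P}_i$ is the Markov kernel that rerandomizes the $i$-th coordinate according to the conditional distribution of $\pi$ given all other coordinates; it acts on functions by $\mathsf{P}_i f(x)=\mathbb{E}_{X\sim\pi}[f(X)\mid X_{-i}=x_{-i}]$, where $x_{-i}$ is the restriction of $x$ to the coordinates other than $i$. The chain is considered on the support of $\pi$, which is assumed to contain at least two points, and the chain $\mathsf{P}$ is assumed irreducible and aperiodic there. On real-valued functions, $\|f\|_\pi=\sqrt{\sum_x f(x)^2\pi(x)}$. Define $$\|\mathsf{P}\|_{\pi,\mathsf{op}}=\max_{f\ne0:\,\mathbb{E}_\pi[f]=0}\frac{\|\mathsf{P}f\|_\pi}{\|f\|_\pi},\qquad \gamma_{\mathsf{P}}=1-\|\mathsf{P}\|_{\pi,\mathsf{op}}.$$ With $d_{\mathsf{TV}}(\mu,\nu)=\frac12\sum_x|\mu(x)-\nu(x)|$, the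 mixing time is $t^{\mathsf{P}}_{\mathsf{mix}}(\varepsilon)=\min\{t\ge0:\max_x d_{\mathsf{TV}}(\mathsf{P}^t(x,\cdot),\pi)\le\varepsilon\}$, the maximum being over the support of $\pi$. *)

(* Defs.v *)
From HB Require Import structures.
From mathcomp Require Import all_boot all_order all_algebra.
From mathcomp Require Import all_classical all_reals all_analysis.

Set Implicit Arguments.
Unset Strict Implicit.
Unset Printing Implicit Defensive.

Import Order.TTheory GRing.Theory Num.Theory.
Local Open Scope classical_set_scope.
Local Open Scope ring_scope.

(* A transition matrix is some [P : 'M[R]_N]; it acts on functions, seen as
   column vectors, by [P *m f].  The stationary distribution is a row vector
   [p : 'rV[R]_N]. *)

Definition irreducible_chain (R : realType) (N : nat) (P : 'M[R]_N) : Prop :=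
  forall a b : 'I_N, exists t : nat, 0 < (P ^+ t) a b.

(* The gcd of the set of return times of every state is 1, i.e. 1 is the only
   common divisor of its elements. *)
Definition aperiodic_chain (R : realType) (N : nat) (P : 'M[R]_N) : Prop :=
  forall (a : 'I_N) (d : nat),
    (forall t : nat, (0 < t)%N -> 0 < (P ^+ t) a a -> (d %| t)%N) -> d = 1%N.

Definition expect (R : realType) (N : nat) (p : 'rV[R]_N) (f : 'cV[R]_N) : R :=
  \sum_a p 0 a * f a 0.

Definition norm2 (R : realType) (N : nat) (p : 'rV[R]_N) (f : 'cV[R]_N) : R :=
  Num.sqrt (\sum_a f a 0 ^+ 2 * p 0 a).

(* The supremum is a maximum when [p] has positive entries and [1 < N]. *)
Definition op_norm (R : realType) (N : nat) (p : 'rV[R]_N) (P : 'M[R]_N) : R :=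
  sup [set r | exists f : 'cV[R]_N,
         [/\ f != 0, expect p f = 0 & r = norm2 p (P *m f) / norm2 p f]].

Definition gap (R : realType) (N : nat) (p : 'rV[R]_N) (P : 'M[R]_N) : R :=
  1 - op_norm p P.

Definition dTV (R : realType) (N : nat) (mu nu : 'rV[R]_N) : R :=
  2^-1 * \sum_a `|mu 0 a - nu 0 a|.

(* [0] is a neutral default for the maximum, as distances are nonnegative. *)
Definition max_dTV (R : realType) (N : nat) (p : 'rV[R]_N) (P : 'M[R]_N)
    (t : nat) : R :=
  \big[Num.max/0]_(a < N) dTV (row a (P ^+ t)) p.

Definition is_mixing_time (R : realType) (N : nat) (p : 'rV[R]_N) (P : 'M[R]_N)
    (eps : R) (t : nat) : Prop :=
  max_dTV p P t <= eps /\ forall s : nat, max_dTV p P s <= eps -> (t <= s)%N.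

Definition product_space (n : nat) (X : 'I_n -> finType) : finType :=
  {dffun forall i : 'I_n, X i}.

Definition is_distribution (R : realType) (T : finType) (pi : T -> R) : Prop :=
  (forall x, 0 <= pi x) /\ \sum_x pi x = 1.

Definition supp (R : realType) (T : finType) (pi : T -> R) : {set T} :=
  [set x | pi x != 0]%SET.

Definition pi_min (R : realType) (T : finType) (pi : T -> R) : R :=
  \big[Num.min/1]_(x : T | pi x != 0) pi x.

(* The chain lives on the support of [pi], whose points are numbered by
   [enum_val : 'I_#|supp pi| -> T]. *)
Definition supp_row (R : realType) (T : finType) (pi : T -> R) :
    'rV[R]_#|supp pi| :=
  \row_a pi (enum_val a).

Definition agree_off (n : nat) (X : 'I_n -> finType) (i : 'I_n)
    (x y : product_space X) : bool :=
  [forall j : 'I_n, (j != i) ==> (x j == y j)].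

(* Entry [(x, y)] is the conditional probability that [X = y] given
   [X_{-i} = x_{-i}]. *)
Definition coord_kernel (R : realType) (n : nat) (X : 'I_n -> finType)
    (pi : product_space X -> R) (i : 'I_n) : 'M[R]_#|supp pi| :=
  \matrix_(a, b)
    let x := enum_val a in let y := enum_val b in
    if agree_off i x y
    then pi y / \sum_(z : product_space X | agree_off i x z) pi z
    else 0.

(* The matrix product [P_n *m ... *m P_1], largest index leftmost. *)
Definition systematic_scan (R : realType) (n : nat) (X : 'I_n -> finType)
    (pi : product_space X -> R) : 'M[R]_#|supp pi| :=
  \prod_(i <- rev (enum 'I_n)) coord_kernel pi i.

(* Main.v *)
Require Import Defs.
From HB Require Import structures.
From mathcomp Require Import all_boot all_order all_algebra.
From mathcomp Require Import all_classical all_reals all_analysis.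
From mathcomp Require Import ring lra.

Set Implicit Arguments.
Unset Strict Implicit.
Unset Printing Implicit Defensive.

Import Order.TTheory GRing.Theory Num.Theory.
Local Open Scope ring_scope.

(** Each [P_i] is an orthogonal projection of [L^2 pi], a conditional
    expectation, and both bounds compare the spectral gap with the decay of
    [P^t] on centered functions in mean square.

    Lower bound.  Orthogonality gives
    [||g - P_i g||^2 = ||g||^2 - ||P_i g||^2], and these losses telescope along
    one scan, so by Cauchy-Schwarz over the [n] factors
    [||f - P f||^2 <= n (||f||^2 - ||P f||^2)]: a function that loses little
    norm is moved little ([scan_kernel_mulmx]).  As [P] is a contraction,
    [||f - P^t f|| <= t ||f - P f||] ([scan_pow_displacement]).  If [t] is at
    least the mixing time, the rows of [P^t - 1 pi] have absolute sums at most
    [1/5] and its [pi]-weighted columns at most [2 pi], so Schur's test gives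
    [||P^t f||^2 <= (2/5) ||f||^2] for centered [f] ([mixing_sqnorm_le]).  Hence
    [f] is moved by an amount comparable to its norm, and
    [||f||^2 <= K n t^2 (||f||^2 - ||P f||^2)] for an absolute [K]
    ([scan_loss]); maximizing over [f] gives [n t^2 gamma >= 1/15]
    ([mixing_gap_ge]).

    Upper bound.  [||P^t f|| <= (1 - gamma)^t ||f||] on centered functions, and
    evaluation at one state costs a factor [pi_min^(-1/2)] ([dTV_sqr_le]); as
    [1 - gamma <= exp (- gamma)], of the order of [log (1 / pi_min) / gamma]
    steps suffice to mix ([max_dTV_le]).

    The quotients make sense because [gamma > 0] ([gap_gt0]), which is the
    lower bound argument again, with a Doeblin minorization of a positive power
    of [P] as the source of contraction in place of mixing. *)

(** * The weighted square norm *)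

Definition sqnorm (R : realType) (N : nat) (p : 'rV[R]_N) (f : 'cV[R]_N) : R :=
  \sum_a f a 0 ^+ 2 * p 0 a.

Definition positive_distribution (R : realType) (N : nat) (p : 'rV[R]_N) :=
  (forall a, 0 < p 0 a) /\ \sum_a p 0 a = 1.

Lemma sqnorm_ge0 (R : realType) (N : nat) (p : 'rV[R]_N) (f : 'cV[R]_N) :
  (forall a, 0 < p 0 a) -> 0 <= sqnorm p f.
Proof.
by move=> p_gt0; apply: sumr_ge0 => a _; rewrite mulr_ge0 ?sqr_ge0 // ltW.
Qed.

Lemma sqnorm_gt0 (R : realType) (N : nat) (p : 'rV[R]_N) (f : 'cV[R]_N) :
  (forall a, 0 < p 0 a) -> f != 0 -> 0 < sqnorm p f.
Proof.
move=> p_gt0; apply: contraNT; rewrite -leNgt => q_le0.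
have q0 : sqnorm p f = 0 by apply/le_anti; rewrite q_le0 sqnorm_ge0.
have term_ge0 (a : 'I_N) : true -> 0 <= f a 0 ^+ 2 * p 0 a.
  by move=> _; rewrite mulr_ge0 ?sqr_ge0 // ltW.
apply/eqP/matrixP => a j; rewrite ord1 mxE.
have /eqP := psumr_eq0P term_ge0 q0 (i := a) isT.
by rewrite mulf_eq0 (gt_eqF (p_gt0 a)) orbF sqrf_eq0 => /eqP.
Qed.

Lemma sqnormN (R : realType) (N : nat) (p : 'rV[R]_N) (f : 'cV[R]_N) :
  sqnorm p (- f) = sqnorm p f.
Proof. by apply: eq_bigr => a _; rewrite mxE sqrrN. Qed.

Lemma norm2E (R : realType) (N : nat) (p : 'rV[R]_N) (f : 'cV[R]_N) :
  norm2 p f = Num.sqrt (sqnorm p f).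
Proof. by []. Qed.

Lemma sqnormD_young (R : realType) (N : nat) (p : 'rV[R]_N) (s : R)
    (f g : 'cV[R]_N) :
  (forall a, 0 < p 0 a) -> 0 < s ->
  sqnorm p (f + g) <= (1 + s) * sqnorm p f + (1 + s^-1) * sqnorm p g.
Proof.
move=> p_gt0 s_gt0; rewrite /sqnorm !mulr_sumr -big_split /=.
apply: ler_sum => a _; rewrite mxE mulrA (mulrA (1 + s^-1)) -mulrDl.
apply: ler_wpM2r; first exact: ltW.
move: (f a 0) (g a 0) => x y.
rewrite -subr_ge0.
suff -> : (1 + s) * x ^+ 2 + (1 + s^-1) * y ^+ 2 - (x + y) ^+ 2
    = s * (x - s^-1 * y) ^+ 2 by rewrite mulr_ge0 ?sqr_ge0 // ltW.
by field; rewrite gt_eqF.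
Qed.

(** One step of the induction that bounds the square norm of a sum of [m] terms
    by [m] times the sum of their square norms; the weight to use in Young's
    inequality is [1 / m]. *)
Lemma sqnormD_step (R : realType) (N : nat) (p : 'rV[R]_N) (m : nat)
    (d e : R) (f g : 'cV[R]_N) :
  (forall a, 0 < p 0 a) -> 0 <= d ->
  sqnorm p f <= m%:R * d -> sqnorm p g <= e ->
  sqnorm p (f + g) <= m.+1%:R * (d + e).
Proof.
move=> p_gt0 d_ge0; case: m => [|m] f_le g_le.
  have -> : f = 0.
    apply/eqP; apply: contraTT f_le => /(sqnorm_gt0 p_gt0).
    by rewrite mul0r -ltNge.
  by rewrite add0r mul1r (le_trans g_le) // lerDr.
have m_gt0 : 0 < m.+1%:R :> R by rewrite ltr0Sn.
have s_gt0 : 0 < m.+1%:R^-1 :> R by rewrite invr_gt0.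
apply: le_trans (sqnormD_young f g p_gt0 s_gt0) _.
rewrite invrK mulrDr; apply: lerD; last first.
  by rewrite nat1r ler_wpM2l // ltW // ltr0Sn.
have -> : m.+2%:R * d = (1 + m.+1%:R^-1) * (m.+1%:R * d).
  by rewrite -(natr1 m.+1); field; rewrite gt_eqF.
by rewrite ler_wpM2l // addr_ge0 // ltW.
Qed.

(** * Orthogonal projections and their products *)

(** What a rerandomization of one coordinate is on [L^2 p]: reversibility makes
    it self-adjoint, so that together with idempotence it is an orthogonal
    projection.  A positive diagonal is kept by products, which makes the
    scan lazy. *)
Record gibbs_kernel (R : realType) (N : nat) (p : 'rV[R]_N) (K : 'M[R]_N) :
    Prop := GibbsKernel {
  gibbs_ge0 : forall a b, 0 <= K a b;
  gibbs_diag : forall a, 0 < K a a;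
  gibbs_stochastic : forall a, \sum_b K a b = 1;
  gibbs_reversible : forall a b, p 0 a * K a b = p 0 b * K b a;
  gibbs_idem : K *m K = K }.

Lemma reversible_adjoint (R : realType) (N : nat) (p : 'rV[R]_N) (K : 'M[R]_N)
    (f g : 'cV[R]_N) :
  (forall a b, p 0 a * K a b = p 0 b * K b a) ->
  \sum_a p 0 a * (K *m f) a 0 * g a 0 = \sum_a p 0 a * f a 0 * (K *m g) a 0.
Proof.
move=> revK.
under eq_bigr do rewrite mxE mulr_sumr mulr_suml.
rewrite exchange_big; apply: eq_bigr => b _ /=.
rewrite mxE mulr_sumr; apply: eq_bigr => a _.
by rewrite mulrA revK; ring.
Qed.

Lemma sqnorm_gibbs_sub (R : realType) (N : nat) (p : 'rV[R]_N) (K : 'M[R]_N)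
    (f : 'cV[R]_N) :
  gibbs_kernel p K -> sqnorm p (f - K *m f) = sqnorm p f - sqnorm p (K *m f).
Proof.
move=> gK; have := reversible_adjoint f (K *m f) (gibbs_reversible gK).
rewrite mulmxA (gibbs_idem gK) => cross.
have -> : sqnorm p (f - K *m f) = sqnorm p f + sqnorm p (K *m f)
    - 2 * \sum_a p 0 a * f a 0 * (K *m f) a 0.
  rewrite /sqnorm mulr_sumr -!big_split -sumrB /=; apply: eq_bigr => a _.
  have -> : (f - K *m f) a 0 = f a 0 - (K *m f) a 0 by rewrite !mxE.
  by ring.
rewrite -cross.
have -> : \sum_a p 0 a * (K *m f) a 0 * (K *m f) a 0 = sqnorm p (K *m f).
  by apply: eq_bigr => a _; ring.
by ring.
Qed.

Lemma sqnorm_gibbs_le (R : realType) (N : nat) (p : 'rV[R]_N) (K : 'M[R]_N)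
    (f : 'cV[R]_N) :
  (forall a, 0 < p 0 a) -> gibbs_kernel p K ->
  sqnorm p (K *m f) <= sqnorm p f.
Proof. by move=> p_gt0 gK; rewrite -subr_ge0 -sqnorm_gibbs_sub ?sqnorm_ge0. Qed.

Lemma gibbs_invariant (R : realType) (N : nat) (p : 'rV[R]_N) (K : 'M[R]_N) :
  gibbs_kernel p K -> p *m K = p.
Proof.
move=> gK; apply/matrixP => i b; rewrite ord1 mxE.
under eq_bigr do rewrite (gibbs_reversible gK).
by rewrite -mulr_sumr (gibbs_stochastic gK) mulr1.
Qed.

(** The properties of [gibbs_kernel] that survive products, together with the
    fact that distinguishes a scan of [m] projections from other contractions:
    a function that loses little norm is moved little. *)
Record scan_kernel (R : realType) (N : nat) (p : 'rV[R]_N) (m : nat)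
    (P : 'M[R]_N) : Prop := ScanKernel {
  scan_ge0 : forall a b, 0 <= P a b;
  scan_diag : forall a, 0 < P a a;
  scan_stochastic : forall a, \sum_b P a b = 1;
  scan_invariant : p *m P = p;
  scan_contracting : forall f, sqnorm p (P *m f) <= sqnorm p f;
  scan_displacement : forall f,
    sqnorm p (f - P *m f) <= m%:R * (sqnorm p f - sqnorm p (P *m f)) }.

Lemma mulmx_ge0 (R : realType) (N : nat) (P Q : 'M[R]_N) :
  (forall a b, 0 <= P a b) -> (forall a b, 0 <= Q a b) ->
  forall a b, 0 <= (P *m Q) a b.
Proof.
by move=> P0 Q0 a b; rewrite mxE sumr_ge0 // => c _; rewrite mulr_ge0.
Qed.

Lemma mulmx_ge_term (R : realType) (N : nat) (P Q : 'M[R]_N) (a b c : 'I_N) :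
  (forall a b, 0 <= P a b) -> (forall a b, 0 <= Q a b) ->
  P a c * Q c b <= (P *m Q) a b.
Proof.
move=> P0 Q0; rewrite mxE (bigD1 c) //= lerDl sumr_ge0 // => d _.
by rewrite mulr_ge0.
Qed.

Lemma mulmx_stochastic (R : realType) (N : nat) (P Q : 'M[R]_N) :
  (forall a, \sum_b P a b = 1) -> (forall a, \sum_b Q a b = 1) ->
  forall a, \sum_b (P *m Q) a b = 1.
Proof.
move=> P1 Q1 a; under eq_bigr do rewrite mxE.
rewrite exchange_big /=; under eq_bigr do rewrite -mulr_sumr Q1 mulr1.
exact: P1.
Qed.

Lemma mx1_stochastic (R : realType) (N : nat) (a : 'I_N) :
  \sum_b (1 : 'M[R]_N) a b = 1.
Proof.
rewrite (bigD1 a) //= !mxE eqxx big1 ?addr0 // => b.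
by rewrite mxE eq_sym => /negPf ->.
Qed.

Lemma mx1_ge0 (R : realType) (N : nat) (a b : 'I_N) :
  0 <= (1 : 'M[R]_N) a b.
Proof. by rewrite mxE; case: eqP. Qed.

(** With [g = P f], the displacement of [K P] splits as
    [f - K g = (f - g) + (g - K g)], and the losses of norm of the two parts add
    up to the total loss; Cauchy-Schwarz over the factors costs the factor
    [m.+1]. *)
Lemma scan_kernel_mulmx (R : realType) (N : nat) (p : 'rV[R]_N) (m : nat)
    (K P : 'M[R]_N) :
  (forall a, 0 < p 0 a) -> gibbs_kernel p K -> scan_kernel p m P ->
  scan_kernel p m.+1 (K *m P).
Proof.
move=> p_gt0 gK sP; split.
- exact: mulmx_ge0 (gibbs_ge0 gK) (scan_ge0 sP).
- move=> a.
  apply: lt_le_trans (mulmx_ge_term a a a (gibbs_ge0 gK) (scan_ge0 sP)).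
  by rewrite mulr_gt0 ?(gibbs_diag gK) ?(scan_diag sP).
- exact: mulmx_stochastic (gibbs_stochastic gK) (scan_stochastic sP).
- by rewrite mulmxA (gibbs_invariant gK) (scan_invariant sP).
- move=> f; rewrite -mulmxA; apply: le_trans (scan_contracting sP f).
  exact: sqnorm_gibbs_le.
- move=> f; rewrite -mulmxA; set g := P *m f.
  have -> : f - K *m g = (f - g) + (g - K *m g) by rewrite addrA subrK.
  have -> : sqnorm p f - sqnorm p (K *m g)
      = (sqnorm p f - sqnorm p g) + (sqnorm p g - sqnorm p (K *m g)) by ring.
  apply: sqnormD_step => //.
  + by rewrite subr_ge0 (scan_contracting sP).
  + exact: scan_displacement.
  + by rewrite sqnorm_gibbs_sub.
Qed.

Lemma scan_kernel1 (R : realType) (N : nat) (p : 'rV[R]_N) :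
  scan_kernel p 0 (1 : 'M[R]_N).
Proof.
split=> [|a|||f|f]; rewrite ?mul1mx ?mulmx1 //.
- exact: mx1_ge0.
- by rewrite mxE eqxx.
- exact: mx1_stochastic.
- rewrite !subrr mulr0 /sqnorm big1 // => a _.
  by rewrite mxE expr0n mul0r.
Qed.

Lemma scan_kernel_prod (R : realType) (N : nat) (p : 'rV[R]_N) (I : Type)
    (r : seq I) (K : I -> 'M[R]_N) :
  (forall a, 0 < p 0 a) -> (forall i, gibbs_kernel p (K i)) ->
  scan_kernel p (size r) (\prod_(i <- r) K i).
Proof.
move=> p_gt0 gK; elim: r => [|i r IH] /=.
  by rewrite big_nil; exact: scan_kernel1.
by rewrite big_cons; exact: scan_kernel_mulmx.
Qed.

Lemma scan_expect (R : realType) (N : nat) (p : 'rV[R]_N) (m : nat)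
    (P : 'M[R]_N) (f : 'cV[R]_N) :
  scan_kernel p m P -> expect p (P *m f) = expect p f.
Proof.
move=> sP; have expectE g : expect p g = (p *m g) 0 0 by rewrite mxE.
by rewrite !expectE mulmxA (scan_invariant sP).
Qed.

(** * Powers of a scan *)

Section Powers.
Context (R : realType) (N : nat) (p : 'rV[R]_N) (m : nat) (P : 'M[R]_N).
Hypotheses (p_gt0 : forall a, 0 < p 0 a) (sP : scan_kernel p m P).

Lemma scan_pow_ge0 t a b : 0 <= (P ^+ t) a b.
Proof.
elim: t a b => [|t IH] a b; first exact: mx1_ge0.
by rewrite exprS; apply: mulmx_ge0; [exact: scan_ge0 sP|exact: IH].
Qed.

Lemma scan_pow_stochastic t a : \sum_b (P ^+ t) a b = 1.
Proof.
elim: t a => [|t IH] a; first exact: mx1_stochastic.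
by rewrite exprS; apply: mulmx_stochastic; [exact: scan_stochastic sP|exact: IH].
Qed.

Lemma scan_pow_invariant t : p *m P ^+ t = p.
Proof.
elim: t => [|t IH]; first by rewrite expr0 mulmx1.
by rewrite exprS -mulmxE mulmxA (scan_invariant sP).
Qed.

Lemma scan_pow_contracting t f : sqnorm p (P ^+ t *m f) <= sqnorm p f.
Proof.
elim: t f => [|t IH] f; first by rewrite expr0 mul1mx.
rewrite exprS -mulmxE -mulmxA; apply: le_trans (IH f).
exact: scan_contracting sP _.
Qed.

Lemma scan_pow_displacement t f :
  sqnorm p (P ^+ t *m f - f) <= t%:R ^+ 2 * sqnorm p (P *m f - f).
Proof.
rewrite expr2 -mulrA; elim: t => [|t IH].
  rewrite expr0 mul1mx subrr /sqnorm mul0r big1 // => a _.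
  by rewrite mxE expr0n mul0r.
have -> : P ^+ t.+1 *m f - f = (P ^+ t *m f - f) + P ^+ t *m (P *m f - f).
  by rewrite mulmxBr mulmxA exprSr -mulmxE [RHS]addrC addrA subrK.
rewrite -{2}natr1 mulrDl mul1r; apply: sqnormD_step => //.
  by rewrite mulr_ge0 ?sqnorm_ge0.
exact: scan_pow_contracting.
Qed.

(** If [P ^+ t] shrinks [f], it moves [f] by an amount comparable to its norm,
    hence so does one scan up to the factor [t]; and one scan cannot move [f]
    without losing norm. *)
Lemma scan_loss t f (s k : R) :
  0 < s -> sqnorm p (P ^+ t *m f) <= k * sqnorm p f ->
  (1 - (1 + s) * k) * sqnorm p f
    <= (1 + s^-1) * (t%:R ^+ 2 * m%:R) * (sqnorm p f - sqnorm p (P *m f)).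
Proof.
move=> s_gt0 shrink.
have := sqnormD_young (P ^+ t *m f) (f - P ^+ t *m f) p_gt0 s_gt0.
rewrite addrC subrK => young.
have far : sqnorm p (f - P ^+ t *m f)
    <= t%:R ^+ 2 * (m%:R * (sqnorm p f - sqnorm p (P *m f))).
  rewrite -sqnormN opprB; apply: le_trans (scan_pow_displacement t f) _.
  by rewrite ler_wpM2l ?sqr_ge0 // -sqnormN opprB (scan_displacement sP).
have s1 : 0 <= 1 + s by rewrite addr_ge0 // ltW.
have s2 : 0 <= 1 + s^-1 by rewrite addr_ge0 // invr_ge0 ltW.
have := ler_wpM2l s1 shrink; have := ler_wpM2l s2 far.
by rewrite mulrBl mul1r !mulrA; lra.
Qed.

(** The positive diagonal makes positivity of an entry persist in time, so that
    one exponent can serve all pairs of states. *)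
Lemma scan_irreducible_pow_gt0 :
  irreducible_chain P -> exists t, forall a b, 0 < (P ^+ t) a b.
Proof.
move=> irrP.
have diag t a : 0 < (P ^+ t) a a.
  elim: t => [|t IH]; first by rewrite expr0 mxE eqxx.
  rewrite exprS.
  apply: lt_le_trans (mulmx_ge_term a a a (scan_ge0 sP) (scan_pow_ge0 t)).
  by rewrite mulr_gt0 // (scan_diag sP).
have [T TP] := choice (fun ab : 'I_N * 'I_N => irrP ab.1 ab.2).
exists (\max_ab T ab)%N => a b.
have T_le : (T (a, b) <= \max_ab T ab)%N by rewrite leq_bigmax.
rewrite -(subnKC T_le) exprD.
apply: lt_le_trans (mulmx_ge_term a b b (scan_pow_ge0 _) (scan_pow_ge0 _)).
by rewrite mulr_gt0 // (TP (a, b)).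
Qed.

End Powers.

(** * Contraction in mean square *)

Lemma weighted_sum_sqr_le (R : realType) (I : finType) (w x : I -> R) :
  (forall i, 0 <= w i) ->
  (\sum_i w i * x i) ^+ 2 <= (\sum_i w i) * \sum_i w i * x i ^+ 2.
Proof.
move=> w0; set S := \sum_i w i; set M := \sum_i w i * x i.
set Q := \sum_i w i * x i ^+ 2.
have S_ge0 : 0 <= S by apply: sumr_ge0.
(* [M / S] is the mean of [x]; its deviations are scaled by [S] because [S] may
   vanish *)
have var : 0 <= \sum_i w i * (S * x i - M) ^+ 2.
  by apply: sumr_ge0 => i _; rewrite mulr_ge0 ?sqr_ge0.
have expand u v : \sum_i w i * (u * x i - v) ^+ 2
    = u ^+ 2 * Q - 2 * u * v * M + v ^+ 2 * S.
  rewrite /Q /M /S !mulr_sumr -sumrB -big_split /=.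
  by apply: eq_bigr => i _; ring.
have varE : \sum_i w i * (S * x i - M) ^+ 2 = S * (S * Q - M ^+ 2).
  by rewrite expand; ring.
have [S_gt0|S_le0] := ltP 0 S.
  by move: var; rewrite varE pmulr_rge0 // subr_ge0.
have S0 : S = 0 by apply/le_anti; rewrite S_le0.
have w_eq0 i : w i = 0 by apply: (psumr_eq0P (P := predT)) => //.
by rewrite /M big1 ?expr0n /= ?S0 ?mul0r // => i _; rewrite w_eq0 mul0r.
Qed.

(** Schur's test: interpolation between the bounds of [A] on bounded functions
    (its rows) and on integrable functions (its [p]-weighted columns). *)
Lemma schur_test (R : realType) (N : nat) (p : 'rV[R]_N) (A : 'M[R]_N)
    (al be : R) (f : 'cV[R]_N) :
  (forall a, 0 < p 0 a) -> 0 <= al ->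
  (forall a, \sum_b `|A a b| <= al) ->
  (forall b, \sum_a p 0 a * `|A a b| <= be * p 0 b) ->
  sqnorm p (A *m f) <= al * be * sqnorm p f.
Proof.
move=> p_gt0 al_ge0 rowA colA.
have pointwise a : (A *m f) a 0 ^+ 2 <= al * \sum_b `|A a b| * f b 0 ^+ 2.
  have abs_le : (A *m f) a 0 ^+ 2 <= (\sum_b `|A a b| * `|f b 0|) ^+ 2.
    rewrite -real_normK ?num_real // ler_pXn2r ?nnegrE ?normr_ge0 //; last first.
      by apply: sumr_ge0 => b _; rewrite mulr_ge0.
    rewrite mxE; apply: le_trans (ler_norm_sum _ _ _) _.
    by apply: ler_sum => b _; rewrite normrM.
  apply: le_trans abs_le _; apply: le_trans (weighted_sum_sqr_le _ _) _ => //.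
  under [X in _ * X <= _]eq_bigr do rewrite real_normK ?num_real //.
  apply: ler_wpM2r (rowA a).
  by apply: sumr_ge0 => b _; rewrite mulr_ge0 ?sqr_ge0.
have le1 : sqnorm p (A *m f)
    <= \sum_a (al * \sum_b `|A a b| * f b 0 ^+ 2) * p 0 a.
  by apply: ler_sum => a _; rewrite ler_wpM2r // ltW.
apply: le_trans le1 _.
have -> : \sum_a (al * \sum_b `|A a b| * f b 0 ^+ 2) * p 0 a
    = al * \sum_b f b 0 ^+ 2 * \sum_a p 0 a * `|A a b|.
  rewrite mulr_sumr; under eq_bigr do rewrite -mulrA mulr_suml mulr_sumr.
  rewrite exchange_big /=; apply: eq_bigr => b _.
  by rewrite !mulr_sumr; apply: eq_bigr => a _; ring.
rewrite -mulrA ler_wpM2l // /sqnorm mulr_sumr ler_sum // => b _.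
by rewrite mulrCA ler_wpM2l ?sqr_ge0.
Qed.

Lemma mulmx_sub_stationary (R : realType) (N : nat) (p : 'rV[R]_N)
    (P : 'M[R]_N) (d : R) (f : 'cV[R]_N) :
  expect p f = 0 -> (\matrix_(a, b) (P a b - d * p 0 b)) *m f = P *m f.
Proof.
move=> f0; apply/matrixP => a j; rewrite ord1 !mxE.
under eq_bigr do rewrite mxE mulrBl -mulrA.
by rewrite sumrB -mulr_sumr -[X in _ - d * X]/(expect p f) f0 mulr0 subr0.
Qed.

(** Mixing in total variation bounds the rows of [P ^+ t] minus its limit by
    [1 / 5], while stationarity bounds the weighted column at [b]
    by [2 * p 0 b]. *)
Lemma mixing_sqnorm_le (R : realType) (N : nat) (p : 'rV[R]_N) (m : nat)
    (P : 'M[R]_N) (t : nat) (f : 'cV[R]_N) :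
  positive_distribution p -> scan_kernel p m P ->
  max_dTV p P t <= 1 / 10 -> expect p f = 0 ->
  sqnorm p (P ^+ t *m f) <= 2 / 5 * sqnorm p f.
Proof.
move=> [p_gt0 p_sum] sP mixed f0.
rewrite -(mulmx_sub_stationary (P ^+ t) 1 f0).
have -> : 2 / 5 = 1 / 5 * 2 :> R by lra.
apply: schur_test => //.
- move=> a; have : dTV (row a (P ^+ t)) p <= 1 / 10.
    apply: (le_trans _ mixed).
    exact: (le_bigmax 0 (fun a => dTV (row a (P ^+ t)) p)).
  rewrite /dTV ler_pdivrMl //; set S := \sum_a _; set S' := \sum_a _.
  have -> : S' = S by apply: eq_bigr => b _; rewrite !mxE mul1r.
  lra.
- move=> b.
  apply: (@le_trans _ _ (\sum_a (p 0 a * (P ^+ t) a b + p 0 a * p 0 b))).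
    apply: ler_sum => a _; rewrite mxE mul1r -mulrDr.
    apply: ler_wpM2l; first exact: ltW.
    apply: le_trans (ler_normB _ _) _.
    by rewrite !ger0_norm ?(scan_pow_ge0 sP) // ltW.
  rewrite big_split /= -mulr_suml p_sum mul1r.
  have -> : \sum_a p 0 a * (P ^+ t) a b = p 0 b.
    by rewrite -[in RHS](scan_pow_invariant sP t) mxE.
  by rewrite mulr_natl mulr2n.
Qed.

(** Doeblin's minorization: a power with positive entries dominates a multiple
    of the stationary kernel, which is invisible to centered functions; what is
    left has total mass less than [1]. *)
Lemma irreducible_sqnorm_lt (R : realType) (N : nat) (p : 'rV[R]_N) (m : nat)
    (P : 'M[R]_N) :
  positive_distribution p -> scan_kernel p m P -> irreducible_chain P ->
  exists (t : nat) (d : R), [/\ 0 < d, d < 1 & forall f : 'cV[R]_N,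
    expect p f = 0 -> sqnorm p (P ^+ t *m f) <= (1 - d) ^+ 2 * sqnorm p f].
Proof.
move=> [p_gt0 p_sum] sP /(scan_irreducible_pow_gt0 sP) [t Pt_gt0].
(* the default [2^-1] keeps [d] away from [1] *)
pose d := \big[Num.min/2^-1]_(ab : 'I_N * 'I_N) (P ^+ t) ab.1 ab.2.
have d_gt0 : 0 < d by apply: lt_bigmin => // ab _.
have d_lt1 : d < 1.
  apply: le_lt_trans (bigmin_le_id _ _ _ _) _; lra.
have p_le1 b : p 0 b <= 1.
  rewrite -p_sum (bigD1 b) //= lerDl sumr_ge0 // => a _; exact: ltW.
have D_ge0 a b : 0 <= (P ^+ t) a b - d * p 0 b.
  rewrite subr_ge0; apply: (@le_trans _ _ d).
    by rewrite ler_piMr // ltW.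
  exact: (bigmin_le_cond _
    (fun ab : 'I_N * 'I_N => (P ^+ t) ab.1 ab.2) (j := (a, b))).
exists t, d; split=> // f f0.
rewrite -(mulmx_sub_stationary (P ^+ t) d f0) expr2.
apply: schur_test => //.
- by rewrite subr_ge0 ltW.
- move=> a; under eq_bigr do rewrite mxE ger0_norm ?D_ge0 //.
  by rewrite sumrB (scan_pow_stochastic sP) -mulr_sumr p_sum mulr1.
- move=> b; under eq_bigr do rewrite mxE ger0_norm ?D_ge0 // mulrBr.
  rewrite sumrB -mulr_suml p_sum mul1r mulrBl mul1r lerD2r.
  by rewrite -[in leRHS](scan_pow_invariant sP t) mxE.
Qed.

(** * The operator norm and the spectral gap *)

Lemma centered_nonzero (R : realType) (N : nat) (p : 'rV[R]_N) :
  (1 < N)%N -> (forall a, 0 < p 0 a) ->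
  exists2 f : 'cV[R]_N, f != 0 & expect p f = 0.
Proof.
move=> N_gt1 p_gt0.
pose x := Ordinal (ltnW N_gt1); pose y := Ordinal N_gt1.
have yx : y != x by [].
(* swapping the weights of two states balances the expectation *)
pose f : 'cV[R]_N :=
  \col_c (if c == x then p 0 y else if c == y then - p 0 x else 0).
exists f.
  apply/negP => /eqP /matrixP /(_ x 0); rewrite !mxE eqxx => /eqP.
  by rewrite gt_eqF.
rewrite /expect (bigD1 x) //= (bigD1 y) //= big1 => [|c /andP[cx cy]].
  by rewrite !mxE !eqxx (negPf yx); ring.
by rewrite mxE (negPf cx) (negPf cy) mulr0.
Qed.

Section Gap.
Context (R : realType) (N : nat) (p : 'rV[R]_N) (m : nat) (P : 'M[R]_N).
Hypotheses (N_gt1 : (1 < N)%N) (p_dist : positive_distribution p).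
Hypothesis sP : scan_kernel p m P.

Let p_gt0 : forall a, 0 < p 0 a := p_dist.1.

Lemma op_ratio_sqr (f : 'cV[R]_N) : f != 0 ->
  (norm2 p (P *m f) / norm2 p f) ^+ 2 * sqnorm p f = sqnorm p (P *m f).
Proof.
move=> /(sqnorm_gt0 p_gt0) q_gt0.
rewrite !norm2E exprMn exprVn !sqr_sqrtr ?sqnorm_ge0 //.
by rewrite divfK // gt_eqF.
Qed.

Lemma op_ratio_ge0 (f : 'cV[R]_N) : 0 <= norm2 p (P *m f) / norm2 p f.
Proof. by rewrite divr_ge0 ?sqrtr_ge0. Qed.

Lemma op_ratio_le1 (f : 'cV[R]_N) : f != 0 ->
  norm2 p (P *m f) / norm2 p f <= 1.
Proof.
move=> f0; have q_gt0 := sqnorm_gt0 p_gt0 f0.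
rewrite -(@expr_le1 _ 2) ?op_ratio_ge0 // -(ler_pM2r q_gt0).
rewrite mul1r op_ratio_sqr //.
exact: scan_contracting sP _.
Qed.

Local Notation ratios := [set r | exists f : 'cV[R]_N,
  [/\ f != 0, expect p f = 0 & r = norm2 p (P *m f) / norm2 p f]]%classic.

Lemma op_ratios_nonempty : (ratios !=set0)%classic.
Proof.
have [f f0 ef] := centered_nonzero N_gt1 p_gt0.
by exists (norm2 p (P *m f) / norm2 p f), f.
Qed.

Lemma op_ratio_le (f : 'cV[R]_N) : f != 0 -> expect p f = 0 ->
  norm2 p (P *m f) / norm2 p f <= op_norm p P.
Proof.
move=> f0 ef; apply: ub_le_sup; last by exists f.
by exists 1 => r [g [g0 _ ->]]; exact: op_ratio_le1.
Qed.

Lemma op_norm_ge0 : 0 <= op_norm p P.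
Proof.
have [f f0 ef] := centered_nonzero N_gt1 p_gt0.
exact: le_trans (op_ratio_ge0 f) (op_ratio_le f0 ef).
Qed.

Lemma gap_le1 : gap p P <= 1.
Proof. by rewrite /gap lerBlDr lerDl op_norm_ge0. Qed.

Lemma sqnorm_pow_le (t : nat) (f : 'cV[R]_N) : expect p f = 0 ->
  sqnorm p (P ^+ t *m f) <= op_norm p P ^+ t ^+ 2 * sqnorm p f.
Proof.
elim: t f => [|t IH] f ef; first by rewrite !expr0 mul1mx expr1n mul1r.
have step : sqnorm p (P *m f) <= op_norm p P ^+ 2 * sqnorm p f.
  have [->|f0] := eqVneq f 0.
    rewrite mulmx0 /sqnorm !big1 ?mulr0 // => a _;
    by rewrite mxE expr0n mul0r.
  rewrite -op_ratio_sqr // ler_wpM2r ?sqnorm_ge0 //.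
  by rewrite ler_pXn2r ?nnegrE ?op_ratio_ge0 ?op_norm_ge0 ?op_ratio_le.
rewrite exprSr -mulmxE -mulmxA.
apply: le_trans (IH _ _) _; first by rewrite (scan_expect _ sP).
rewrite (exprSr _ t) exprMn -[leRHS]mulrA.
by apply: ler_wpM2l; first exact: sqr_ge0.
Qed.

(** A ratio [r] in [0, 1] satisfies [1 - r^2 <= 2 (1 - r)], so half of a
    relative loss of squared norm is a lower bound for the loss of norm. *)
Lemma gap_ge (k B : R) : 0 <= B ->
  (forall f, expect p f = 0 ->
    k * sqnorm p f <= B * (sqnorm p f - sqnorm p (P *m f))) ->
  k <= 2 * B * gap p P.
Proof.
move=> B_ge0 loss.
have ratio_le f : f != 0 -> expect p f = 0 ->
    k <= 2 * B * (1 - norm2 p (P *m f) / norm2 p f).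
  move=> f0 ef; have q_gt0 := sqnorm_gt0 p_gt0 f0.
  have := loss f ef; rewrite -op_ratio_sqr //.
  have := op_ratio_le1 f0; have := op_ratio_ge0 f.
  move: (_ / _) => r r_ge0 r_le1.
  rewrite -[X in _ * (X - _)]mul1r -mulrBl mulrA ler_pM2r // => k_le.
  apply: le_trans k_le _.
  have : 0 <= B * (1 - r) * (1 - r) by rewrite !mulr_ge0 ?subr_ge0.
  by nra.
have [B_gt0|B_le0] := ltP 0 B; last first.
  have B0 : B = 0 by apply/le_anti; rewrite B_le0.
  have [f f0 ef] := centered_nonzero N_gt1 p_gt0.
  by have := ratio_le f f0 ef; rewrite B0 mulr0 !mul0r.
suff : op_norm p P <= 1 - k / (2 * B).
  by rewrite lerBrDl -lerBrDr ler_pdivrMr ?mulr_gt0 // mulrC.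
apply: ge_sup; first exact: op_ratios_nonempty.
move=> _ [f [f0 ef ->]]; rewrite lerBrDl -lerBrDr ler_pdivrMr ?mulr_gt0 //.
by rewrite mulrC ratio_le.
Qed.

(** Some power contracts by [1 - d] in norm; in [scan_loss] the weight [d]
    leaves [(1 + d) (1 - d)^2 < 1]. *)
Lemma gap_gt0 : irreducible_chain P -> 0 < gap p P.
Proof.
move=> irrP.
have [t [d [d_gt0 d_lt1 shrink]]] := irreducible_sqnorm_lt p_dist sP irrP.
pose B := (1 + d^-1) * (t%:R ^+ 2 * m%:R).
have B_ge0 : 0 <= B.
  by rewrite !mulr_ge0 ?sqr_ge0 ?ler0n // addr_ge0 // invr_ge0 ltW.
have := gap_ge B_ge0 (fun f ef => scan_loss p_gt0 sP d_gt0 (shrink f ef)).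
have k_gt0 : 0 < 1 - (1 + d) * (1 - d) ^+ 2.
  have : 0 < d * (1 - d) by rewrite mulr_gt0 ?subr_gt0.
  by nra.
move=> /(lt_le_trans k_gt0).
have [//|gap_le0] := ltP 0 (gap p P).
by rewrite ltNge mulr_ge0_le0 // mulr_ge0.
Qed.

Lemma mixing_gap_ge (t : nat) : max_dTV p P t <= 1 / 10 ->
  1 / 15 <= t%:R ^+ 2 * (m%:R * gap p P).
Proof.
move=> mixed; have s_gt0 : 0 < 2^-1 :> R by lra.
have B_ge0 : 0 <= (1 + 2^-1^-1) * (t%:R ^+ 2 * m%:R) :> R.
  by rewrite !mulr_ge0 ?sqr_ge0 ?ler0n // invrK; lra.
have := gap_ge B_ge0 (fun f ef =>
  scan_loss p_gt0 sP s_gt0 (mixing_sqnorm_le p_dist sP mixed ef)).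
by rewrite invrK mulrA; lra.
Qed.

(** The row of [P ^+ t] is tested against the sign of its deviation from [p]:
    the total variation distance becomes a value of [P ^+ t] on a centered
    function of norm at most [1], and one value costs a factor [1 / p 0 a] in
    squared norm. *)
Lemma dTV_sqr_le (t : nat) (a : 'I_N) :
  (2 * dTV (row a (P ^+ t)) p) ^+ 2 * p 0 a <= op_norm p P ^+ t ^+ 2.
Proof.
pose s b : R := Num.sg ((P ^+ t) a b - p 0 b).
pose e := \sum_b p 0 b * s b.
pose f : 'cV[R]_N := \col_b (s b - e).
have ef : expect p f = 0.
  rewrite /expect; under eq_bigr do rewrite mxE mulrBr.
  by rewrite sumrB -mulr_suml p_dist.2 mul1r subrr.
have -> : 2 * dTV (row a (P ^+ t)) p = (P ^+ t *m f) a 0.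
  rewrite /dTV mulrA divff ?mul1r ?pnatr_eq0 // mxE.
  under [RHS]eq_bigr do rewrite mxE mulrBr.
  rewrite sumrB -mulr_suml (scan_pow_stochastic sP) mul1r -sumrB.
  by apply: eq_bigr => b _; rewrite mxE normrEsg -/(s b); ring.
have f_le1 : sqnorm p f <= 1.
  have -> : sqnorm p f = \sum_b s b ^+ 2 * p 0 b - e ^+ 2.
    have expand c : \sum_b (s b - c) ^+ 2 * p 0 b
        = \sum_b s b ^+ 2 * p 0 b - 2 * c * e + c ^+ 2 * \sum_b p 0 b.
      rewrite /e !mulr_sumr -sumrB -big_split /=.
      by apply: eq_bigr => b _; ring.
    have -> : sqnorm p f = \sum_b (s b - e) ^+ 2 * p 0 b.
      by apply: eq_bigr => b _; rewrite mxE.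
    by rewrite expand p_dist.2; ring.
  rewrite -[leRHS]subr0; apply: lerB; last exact: sqr_ge0.
  rewrite -[leRHS]p_dist.2; apply: ler_sum => b _.
  by apply: ler_piMl; [exact: ltW|rewrite sqr_sg; case: (_ != 0)].
apply: (@le_trans _ _ (sqnorm p (P ^+ t *m f))).
  rewrite /sqnorm (bigD1 a) //= lerDl sumr_ge0 // => b _.
  by rewrite mulr_ge0 ?sqr_ge0 // ltW.
apply: le_trans (sqnorm_pow_le t ef) _.
by rewrite ler_piMr ?sqr_ge0.
Qed.

End Gap.

(** * Mixing time bounds for a scan *)

(** Beyond [4 log (1 / pm) / gamma] steps the norm has decayed to [pm ^ 4]; of
    the resulting [pm ^ 8] in [dTV_sqr_le] one factor pays for [p 0 a], and
    [pm <= 1 / 2] turns the others into a constant. *)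
Lemma max_dTV_le (R : realType) (N : nat) (p : 'rV[R]_N) (m : nat)
    (P : 'M[R]_N) (pm : R) (t : nat) :
  (1 < N)%N -> positive_distribution p -> scan_kernel p m P ->
  0 < pm -> pm <= 1 / 2 -> (forall a, pm <= p 0 a) ->
  4 * ln (1 / pm) <= gap p P * t%:R -> max_dTV p P t <= 1 / 10.
Proof.
move=> N_gt1 p_dist sP pm_gt0 pm_le_half pm_le t_ge.
have rho_ge0 := op_norm_ge0 N_gt1 p_dist sP.
have rho_t : op_norm p P ^+ t <= pm ^+ 4.
  apply: (@le_trans _ _ (expR (- gap p P) ^+ t)).
    apply: lerXn2r; rewrite ?nnegrE ?expR_ge0 //.
    by apply: le_trans (expR_ge1Dx _); rewrite /gap; lra.
  have -> : pm ^+ 4 = expR (4 * ln pm) by rewrite expRM_natl lnK // posrE.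
  rewrite -expRM_natl ler_expR.
  by move: t_ge; rewrite div1r lnV ?posrE //; lra.
apply: bigmax_le => [|a _]; first by lra.
have := dTV_sqr_le N_gt1 p_dist sP t a.
set D := dTV _ _ => D_le.
have pm8 : op_norm p P ^+ t ^+ 2 <= p 0 a / 128.
  apply: (@le_trans _ _ ((pm ^+ 4) ^+ 2)).
    by rewrite ler_pXn2r ?nnegrE ?exprn_ge0 // ltW.
  have -> : (pm ^+ 4) ^+ 2 = pm * pm ^+ 7 by ring.
  apply: ler_pM; rewrite ?exprn_ge0 ?(ltW pm_gt0) //.
  have -> : 128^-1 = (1 / 2) ^+ 7 :> R by field.
  by rewrite ler_pXn2r ?nnegrE ?(ltW pm_gt0) //; lra.
have : (2 * D) ^+ 2 <= 128^-1.
  by rewrite -(ler_pM2r (p_dist.1 a)) [leRHS]mulrC; apply: le_trans D_le pm8.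
by nra.
Qed.

(** Some time mixes by [max_dTV_le], so that the mixing time exists and is no
    later; [mixing_gap_ge] at the mixing time itself bounds it from below. *)
Theorem scan_mixing_time (R : realType) (N : nat) (p : 'rV[R]_N) (m : nat)
    (P : 'M[R]_N) (pm : R) :
  (1 < N)%N -> positive_distribution p -> scan_kernel p m P ->
  irreducible_chain P -> 0 < pm -> (forall a, pm <= p 0 a) ->
  exists t : nat, [/\ is_mixing_time p P (1 / 10) t,
    1 / 4 / Num.sqrt (m%:R * gap p P) <= t%:R &
    t%:R <= 6 / gap p P * ln (1 / pm)].
Proof.
move=> N_gt1 p_dist sP irrP pm_gt0 pm_le.
have g_gt0 := gap_gt0 N_gt1 p_dist sP irrP.
have g_le1 := gap_le1 N_gt1 p_dist sP.
have pm_le_half : pm <= 1 / 2.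
  pose x := Ordinal (ltnW N_gt1); pose y := Ordinal N_gt1.
  have : pm + pm <= 1; last by lra.
  rewrite -p_dist.2 (bigD1 x) //= (bigD1 y) //= addrA -[leLHS]addr0.
  rewrite !lerD ?pm_le // sumr_ge0 // => a _; exact: ltW (p_dist.1 a).
have L_ge : 1 / 2 <= ln (1 / pm).
  rewrite (div1r pm) lnV ?posrE //.
  have -> : pm = 1 + (pm - 1) by ring.
  have := @le_ln1Dx R (pm - 1); lra.
have L_ge0 : 0 <= 4 * ln (1 / pm) / gap p P by rewrite divr_ge0 ?ltW //; lra.
(* rounding up costs [1], absorbed in the constant as
   [1 / 2 <= ln (1 / pm)] and [gap p P <= 1] *)
pose t0 := (Num.truncn (4 * ln (1 / pm) / gap p P)).+1.
have mixed0 : max_dTV p P t0 <= 1 / 10.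
  apply: (max_dTV_le N_gt1 p_dist sP pm_gt0 pm_le_half pm_le).
  by rewrite (mulrC (gap p P)) -ler_pdivrMr // ltW // truncnS_gt.
have ex_mixed : exists t, max_dTV p P t <= 1 / 10 by exists t0.
case: (ex_minnP ex_mixed) => t mixed t_min; exists t; split=> //.
  have := mixing_gap_ge N_gt1 p_dist sP mixed.
  set h := m%:R * gap p P => h_ge.
  have h_gt0 : 0 < h.
    rewrite lt_neqAle mulr_ge0 ?ler0n 1?ltW // andbT eq_sym.
    by apply/eqP => h0; move: h_ge; rewrite h0 mulr0; lra.
  rewrite ler_pdivrMr ?sqrtr_gt0 //.
  have rhs_ge0 : 0 <= t%:R * Num.sqrt h by rewrite mulr_ge0 ?ler0n ?sqrtr_ge0.
  have quarter_ge0 : 0 <= 1 / 4 :> R by lra.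
  rewrite -(@ler_pXn2r _ 2) ?nnegrE // [leRHS]exprMn sqr_sqrtr; last exact: ltW.
  lra.
apply: (@le_trans _ _ t0%:R); first by rewrite ler_nat t_min.
have [t0_le _] := andP (truncn_itv L_ge0).
rewrite /t0 -natr1.
have one_le : 1 <= 2 * ln (1 / pm) / gap p P.
  by rewrite ler_pdivlMr //; lra.
have -> : 6 / gap p P * ln (1 / pm)
  = 4 * ln (1 / pm) / gap p P + 2 * ln (1 / pm) / gap p P.
  by field; rewrite gt_eqF.
exact: lerD.
Qed.

(** * The systematic scan *)

(** The normalization is constant on each class, whence reversibility; so the
    states of a class share one row, and averaging these equal rows returns it,
    whence idempotence. *)
Lemma gibbs_kernel_classes (R : realType) (N : nat) (p : 'rV[R]_N)
    (e : rel 'I_N) :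
  (forall a, 0 < p 0 a) -> reflexive e -> symmetric e -> transitive e ->
  gibbs_kernel p
    (\matrix_(a, b) if e a b then p 0 b / \sum_(c | e a c) p 0 c else 0).
Proof.
move=> p_gt0 e_refl e_sym e_trans.
have e_class a b : e a b -> e a =1 e b.
  move=> eab c; apply/idP/idP; last exact: e_trans.
  by apply: e_trans; rewrite e_sym.
pose Z a := \sum_(c | e a c) p 0 c.
have Z_class a b : e a b -> Z a = Z b.
  by move=> eab; apply: eq_bigl; exact: e_class.
have Z_gt0 a : 0 < Z a.
  rewrite /Z (bigD1 a (e_refl a)) /=; apply: ltr_pwDl (p_gt0 a) _.
  by apply: sumr_ge0 => c _; exact: ltW.
have row_sum a : \sum_b (if e a b then p 0 b / Z a else 0) = 1.
  by rewrite -big_mkcond /= -mulr_suml divff // gt_eqF //; exact: Z_gt0.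
set K := \matrix_(_, _) _.
have KE a b : K a b = if e a b then p 0 b / Z a else 0 by rewrite mxE.
split.
- by move=> a b; rewrite KE; case: ifP => // _; rewrite divr_ge0 // ltW.
- by move=> a; rewrite KE e_refl divr_gt0.
- by move=> a; under eq_bigr do rewrite KE; exact: row_sum.
- move=> a b; rewrite !KE (e_sym b a); case: ifP => [eab|_];
    last by rewrite !mulr0.
  by rewrite (Z_class _ _ eab); ring.
- apply/matrixP => a b; rewrite mxE.
  transitivity (\sum_c K a c * K a b).
    apply: eq_bigr => c _; rewrite !KE; case: (boolP (e a c)) => [eac|_].
      by rewrite (e_class _ _ eac) (Z_class _ _ eac).
    by rewrite !mul0r.
  by rewrite -mulr_suml; under eq_bigr do rewrite KE; rewrite row_sum mul1r.
Qed.

Section Scan.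
Context (R : realType) (n : nat) (X : 'I_n -> finType).
Context (pi : product_space X -> R).
Hypothesis pi_dist : is_distribution pi.

Lemma sum_supp (A : pred (product_space X)) :
  \sum_(z | A z) pi z = \sum_(c < #|supp pi| | A (enum_val c)) pi (enum_val c).
Proof.
rewrite [RHS]big_mkcond [LHS]big_mkcond /=.
rewrite -(big_enum_val (fun z => if A z then pi z else 0)).
rewrite [RHS]big_mkcond; apply: eq_bigr => z _; rewrite inE.
by case: eqP => //= ->; case: ifP.
Qed.

Lemma supp_row_positive : positive_distribution (supp_row pi).
Proof.
split=> [a|].
  rewrite mxE lt_neqAle eq_sym (pi_dist.1 _) andbT.
  by have := enum_valP a; rewrite inE.
by under eq_bigr do rewrite mxE; rewrite -(sum_supp predT) pi_dist.2.
Qed.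

Lemma coord_kernel_gibbs (i : 'I_n) :
  gibbs_kernel (supp_row pi) (coord_kernel pi i).
Proof.
pose e (a b : 'I_#|supp pi|) := agree_off i (enum_val a) (enum_val b).
have -> : coord_kernel pi i = \matrix_(a, b)
    if e a b then supp_row pi 0 b / \sum_(c | e a c) supp_row pi 0 c else 0.
  apply/matrixP => a b; rewrite !mxE /e sum_supp.
  by under [X in _ = if _ then _ / X else _]eq_bigr do rewrite mxE.
apply: gibbs_kernel_classes; first exact: supp_row_positive.1.
- by move=> a; apply/forallP => j; rewrite eqxx implybT.
- by move=> a b; apply: eq_forallb => j; rewrite (eq_sym (enum_val a j)).
- move=> b a c /forallP ab /forallP bc; apply/forallP => j.
  apply/implyP => ji; rewrite (eqP (implyP (ab j) ji)).
  exact: (implyP (bc j)).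
Qed.

Lemma systematic_scan_kernel :
  scan_kernel (supp_row pi) n (systematic_scan pi).
Proof.
have := scan_kernel_prod (rev (enum 'I_n))
  supp_row_positive.1 coord_kernel_gibbs.
by rewrite size_rev size_enum_ord.
Qed.

Lemma pi_min_gt0 : 0 < pi_min pi.
Proof.
by apply: lt_bigmin => // x x0; rewrite lt_neqAle eq_sym x0 (pi_dist.1 x).
Qed.

Lemma pi_min_le (a : 'I_#|supp pi|) : pi_min pi <= supp_row pi 0 a.
Proof.
by rewrite mxE; apply: bigmin_le_cond; have := enum_valP a; rewrite inE.
Qed.

End Scan.

Theorem corollary2p1 (R : realType) :
  exists c C : R, 0 < c /\ 0 < C /\
    forall (n : nat) (X : 'I_n -> finType) (pi : product_space X -> R),
      is_distribution pi ->
      (1 < #|supp pi|)%N ->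
      irreducible_chain (systematic_scan pi) ->
      aperiodic_chain (systematic_scan pi) ->
      exists t : nat,
        is_mixing_time (supp_row pi) (systematic_scan pi) (1 / 10) t /\
        c / Num.sqrt (n%:R * gap (supp_row pi) (systematic_scan pi)) <= t%:R /\
        t%:R <= C / gap (supp_row pi) (systematic_scan pi)
                * ln (1 / pi_min pi).
Proof.
exists (1 / 4), 6; do 2!(split; first by lra).
move=> n X pi pi_dist supp_gt1 irr _.
have [t [mix lower upper]] := scan_mixing_time supp_gt1
  (supp_row_positive pi_dist) (systematic_scan_kernel pi_dist) irr
  (pi_min_gt0 pi_dist) (@pi_min_le _ _ _ pi).
by exists t.
Qed.
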